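(* Let $n\ge 1$ be an integer, $U\in K_{0,n}$ and $C\subseteq\{2,3,\dots,n\}$. Then $$UE_C=\zeta_C^R(U)\,E_C+\zeta_C^I(U)\,O_C.$$
   Context: $K_{0,n}$ is the real associative algebra with unity generated by $e_1,\dots,e_n$ subject to $e_i^2=-1$ and $e_ie_j=e_je_i$ for all $i,j\in\{1,\dots,n\}$. For $A=\{i_1<\cdots<i_l\}\subseteq\{1,\dots,n\}$ put $e_A:=e_{i_1}\cdots e_{i_l}$, with $e_{\{\}}:=1$; the elements $e_A$, $A\subseteq\{1,\dots,n\}$, form a basis of $K_{0,n}$ as a real vector space (dimension $2^n$). For $U=\sum_A a_Ae_A$ with $a_A\in\mathbb{R}$, the grade-$k$ projection is $\langle U\rangle_k:=\sum_{|A|=k}a_Ae_A$ (zero if $k>n$). Operations of conjugation: for $l\in\{1,\dots,n\}$, $U\mapsto U^{(l)}$ is the linear map on $K_{0,n}$ replacing the generator $e_l$ by $-e_l$, i.e. $e_A^{(l)}=-e_A$ if $l\in A$ and $e_A^{(l)}=e_A$ if $l\notin A$. For $B=\{i_1,\dots,i_k\}\subseteq\{1,\dots,n\}$, $U^{(B)}$ denotes the result of applying the conjugations $(i_1),\dots,(i_k)$ successively (they commute), with $U^{(\{\})}:=U$. Define $f:=\frac{1}{2^{n-1}}\sum_{A\subseteq\{1,\dots,n\}}e_A\in K_{0,n}$, $$E:=\sum_{k=0}^{\lfloor n/2\rfloor}(-1)^k\langle f\rangle_{2k},\qquad O:=\sum_{k=0}^{\lfloor n/2\rfloor}(-1)^k\langle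 f\rangle_{2k+1},$$ and, for $B\subseteq\{2,3,\dots,n\}$, $E_B:=E^{(B)}$ and $O_B:=O^{(B)}$. For $A\subseteq\{1,\dots,n\}$ let $\gamma_A:K_{0,n}\to\mathbb{C}$ be the $\mathbb{R}$-linear map with $\gamma_A(e_D):=(-1)^{|A\cap D|}\,i^{|D|}$ for all $D\subseteq\{1,\dots,n\}$, and define $\zeta_A^R,\zeta_A^I:K_{0,n}\to\mathbb{R}$ by $\zeta_A^R(U):=\Re(\gamma_A(U))$ and $\zeta_A^I(U):=\Im(\gamma_A(U))$ (real and imaginary parts). *)

(* Defs.v *)
From HB Require Import structures.
From mathcomp Require Import all_boot all_order all_algebra.
From mathcomp Require Import reals.
From mathcomp Require Import complex.
Set Implicit Arguments.
Unset Strict Implicit.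
Unset Printing Implicit Defensive.
Import Order.TTheory GRing.Theory Num.Theory.
Local Open Scope ring_scope.

(* The index set {1, ..., n} is rendered by 'I_n, the ordinal i standing for
   i + 1; thus C is contained in {2, ..., n} when 0 < i for every i in C. *)

Section SymmetricDifference.
Variable n : nat.
Implicit Types A B C : {set 'I_n}.

Definition symdiff A B : {set 'I_n} := [set i | (i \in A) (+) (i \in B)].

Lemma symdiffC : commutative symdiff.
Proof. by move=> A B; apply/setP=> i; rewrite !inE addbC. Qed.

Lemma symdiffA : associative symdiff.
Proof. by move=> A B C; apply/setP=> i; rewrite !inE addbA. Qed.

Lemma symdiff0s : left_id set0 symdiff.
Proof. by move=> A; apply/setP=> i; rewrite !inE. Qed.

Lemma sign_cardE (R : comPzRingType) (A : {set 'I_n}) :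
  (-1) ^+ #|A| = \prod_i (-1) ^+ (i \in A) :> R.
Proof.
rewrite -prodr_const [LHS]big_mkcond /=.
by apply: eq_bigr => i _; case: (i \in A).
Qed.

Lemma sign_symdiff (R : comPzRingType) A B C :
  (-1) ^+ #|A :&: B| * (-1) ^+ #|symdiff A B :&: C|
  = (-1) ^+ #|B :&: C| * (-1) ^+ #|A :&: symdiff B C| :> R.
Proof.
rewrite !sign_cardE -!big_split /=; apply: eq_bigr => i _.
rewrite !inE -!signr_addb; congr ((-1) ^+ nat_of_bool _).
by case: (i \in A); case: (i \in B); case: (i \in C).
Qed.

End SymmetricDifference.

(* K_{0,n}, as coordinate vectors over the basis (e_A).  The generators commute
   and each i in both A and B yields e_i ^ 2 = -1, so that
   e_A e_B = (-1)^|A :&: B| e_(symdiff A B).  The presentation by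
   e_i ^ 2 = -1 and e_i e_j = e_j e_i is gen_sqr, gen_comm and K0_universal. *)
Definition K0 (R : realType) (n : nat) : Type := {ffun {set 'I_n} -> R^o}.

HB.instance Definition _ (R : realType) (n : nat) :=
  GRing.Lmodule.copy (K0 R n) {ffun {set 'I_n} -> R^o}.

Definition coef (R : realType) (n : nat) (U : K0 R n) (A : {set 'I_n}) : R :=
  (U : {ffun {set 'I_n} -> R^o}) A.

Definition K0_basis (R : realType) (n : nat) (A : {set 'I_n}) : K0 R n :=
  [ffun D => (D == A)%:R].
Arguments K0_basis R {n} A.

HB.lock Definition K0_mul (R : realType) (n : nat) (U V : K0 R n) : K0 R n :=
  \sum_A \sum_B
    (coef U A * coef V B * (-1) ^+ #|A :&: B|) *: K0_basis R (symdiff A B).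

Section Algebra.
Variables (R : realType) (n : nat).
Local Notation K := (K0 R n).
Local Notation K0_mul := (@K0_mul R n).
Local Notation K0_basis := (@K0_basis R n).
Implicit Types (U V W : K) (A B C D : {set 'I_n}).

Lemma coefD U V A : coef (U + V) A = coef U A + coef V A.
Proof. by rewrite /coef ffunE. Qed.

Lemma coefZ a U A : coef (a *: U) A = a * coef U A.
Proof. by rewrite /coef ffunE. Qed.

Lemma coef_sum I r (P : pred I) (F : I -> K) A :
  coef (\sum_(i <- r | P i) F i) A = \sum_(i <- r | P i) coef (F i) A.
Proof. by rewrite /coef sum_ffunE. Qed.

Lemma coef_basis A D : coef (K0_basis A) D = (D == A)%:R.
Proof. by rewrite /coef ffunE. Qed.

Lemma coefP U V : (forall A, coef U A = coef V A) -> U = V.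
Proof. by move=> eqUV; apply/ffunP. Qed.

Lemma K0_expand_basis U : U = \sum_A coef U A *: K0_basis A.
Proof.
apply: coefP => D; rewrite coef_sum (bigD1 D) //= coefZ coef_basis eqxx mulr1.
rewrite big1 ?addr0 // => A neqAD.
by rewrite coefZ coef_basis eq_sym (negPf neqAD) mulr0.
Qed.

Lemma K0_mulDl : left_distributive K0_mul +%R.
Proof.
move=> U V W; rewrite unlock -big_split; apply: eq_bigr => A _ /=.
rewrite -big_split; apply: eq_bigr => B _ /=.
by rewrite -scalerDl coefD !mulrDl.
Qed.

Lemma K0_mulC : commutative K0_mul.
Proof.
move=> U V; rewrite unlock exchange_big; apply: eq_bigr => A _ /=.
apply: eq_bigr => B _; rewrite symdiffC setIC.
by rewrite [coef U B * _]mulrC.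
Qed.

Lemma K0_mulZl a U V : K0_mul (a *: U) V = a *: K0_mul U V.
Proof.
rewrite unlock scaler_sumr; apply: eq_bigr => A _.
rewrite scaler_sumr; apply: eq_bigr => B _.
by rewrite scalerA coefZ !mulrA.
Qed.

Lemma K0_mulZr a U V : K0_mul U (a *: V) = a *: K0_mul U V.
Proof. by rewrite K0_mulC K0_mulZl K0_mulC. Qed.

Lemma K0_mul_suml I r (P : pred I) (F : I -> K) V :
  K0_mul (\sum_(i <- r | P i) F i) V = \sum_(i <- r | P i) K0_mul (F i) V.
Proof.
elim/big_rec2: _ => [|i W1 W2 _ <-]; last by rewrite K0_mulDl.
by rewrite -(scale0r 0) K0_mulZl !scale0r.
Qed.

Lemma K0_mul_sumr I r (P : pred I) (F : I -> K) V :
  K0_mul V (\sum_(i <- r | P i) F i) = \sum_(i <- r | P i) K0_mul V (F i).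
Proof.
by rewrite K0_mulC K0_mul_suml; apply: eq_bigr => i _; rewrite K0_mulC.
Qed.

Lemma K0_mul_basis A B :
  K0_mul (K0_basis A) (K0_basis B)
  = (-1) ^+ #|A :&: B| *: K0_basis (symdiff A B).
Proof.
rewrite unlock (bigD1 A) //= [X in _ + X]big1 ?addr0 => [|C neqCA]; last first.
  rewrite big1 // => D _.
  by rewrite coef_basis (negPf neqCA) !mul0r scale0r.
rewrite (bigD1 B) //= [X in _ + X]big1 ?addr0 => [|D neqDB]; last first.
  by rewrite [coef (K0_basis B) D]coef_basis (negPf neqDB) mulr0 mul0r scale0r.
by rewrite !coef_basis !eqxx !mul1r.
Qed.

Lemma K0_mulA : associative K0_mul.
Proof.
move=> U V W.
rewrite [U in LHS]K0_expand_basis [U in RHS]K0_expand_basis !K0_mul_suml.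
apply: eq_bigr => A _.
rewrite [V in LHS]K0_expand_basis [V in RHS]K0_expand_basis K0_mul_suml !K0_mul_sumr K0_mul_suml.
apply: eq_bigr => B _.
rewrite [W in LHS]K0_expand_basis [W in RHS]K0_expand_basis !K0_mul_sumr; apply: eq_bigr => C _.
rewrite !(K0_mulZl, K0_mulZr, K0_mul_basis) !scalerA symdiffA.
congr (_ *: _).
have := sign_symdiff R A B C.
set s1 := (-1) ^+ #|A :&: B|; set s2 := _ ^+ _; set s3 := _ ^+ _.
set s4 := _ ^+ _ => eqs.
by rewrite -!mulrA -eqs [RHS]mulrCA; congr (_ * _); rewrite [RHS]mulrCA.
Qed.

Lemma K0_mul1l : left_id (K0_basis set0) K0_mul.
Proof.
move=> U; rewrite [RHS]K0_expand_basis [U in LHS]K0_expand_basis K0_mul_sumr; apply: eq_bigr => A _.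
by rewrite K0_mulZr K0_mul_basis set0I cards0 expr0 scale1r symdiff0s.
Qed.

Lemma K0_one_neq0 : K0_basis set0 != 0.
Proof.
apply/eqP => /(congr1 (fun U : K => coef U set0)).
by rewrite coef_basis eqxx /coef ffunE => /eqP; rewrite oner_eq0.
Qed.

HB.instance Definition _ := GRing.Zmodule_isComNzRing.Build (K0 R n)
  K0_mulA K0_mulC K0_mul1l K0_mulDl K0_one_neq0.

Lemma K0_scaleAl (a : R) (U V : K) : a *: (U * V) = (a *: U) * V.
Proof. by rewrite -[RHS]/(K0_mul _ _) K0_mulZl. Qed.

HB.instance Definition _ :=
  GRing.Lmodule_isLalgebra.Build R (K0 R n) K0_scaleAl.
HB.instance Definition _ := GRing.Lalgebra_isComAlgebra.Build R (K0 R n).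

Definition gen (i : 'I_n) : K := K0_basis [set i].

Definition eA A : K := \prod_(i in A) gen i.

Lemma gen_sqr i : gen i * gen i = - 1.
Proof.
rewrite -[gen i * gen i]/(K0_mul _ _) K0_mul_basis setIid cards1 expr1 scaleN1r.
by congr (- K0_basis _); apply/setP=> j; rewrite !inE addbb.
Qed.

Lemma gen_comm i j : gen i * gen j = gen j * gen i.
Proof. exact: mulrC. Qed.

Lemma prod_gen (s : seq 'I_n) :
  uniq s -> \prod_(i <- s) gen i = K0_basis [set i in s].
Proof.
elim: s => [|i s IHs] /= => [_|/andP[i_s /IHs IH]].
  by rewrite big_nil; congr (K0_basis _); apply/setP=> i; rewrite !inE.
rewrite big_cons IH -[LHS]/(K0_mul _ _) K0_mul_basis.
have -> : [set i] :&: [set j in s] = set0.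
  apply/setP=> j; rewrite !inE; case: eqP => // ->; exact: negbTE.
rewrite cards0 expr0 scale1r; congr (K0_basis _); apply/setP=> j.
by rewrite !inE; case: eqP => // ->; rewrite (negPf i_s).
Qed.

Lemma eA_basis A : eA A = K0_basis A.
Proof.
rewrite /eA -big_enum prod_gen ?enum_uniq //.
by congr (K0_basis _); apply/setP=> i; rewrite inE mem_enum.
Qed.

Lemma coef_eA A D : coef (eA A) D = (D == A)%:R.
Proof. by rewrite eA_basis coef_basis. Qed.

Lemma K0_expand U : U = \sum_A coef U A *: eA A.
Proof.
rewrite {1}[U]K0_expand_basis.
by apply: eq_bigr => A _; rewrite eA_basis.
Qed.

End Algebra.
Arguments gen R {n} i.
Arguments eA R {n} A.

Theorem K0_universal (R : realType) (n : nat) (S : algType R) (b : 'I_n -> S) :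
  (forall i, b i * b i = - 1) -> (forall i j, b i * b j = b j * b i) ->
  exists phi : {lrmorphism K0 R n -> S},
    (forall i, phi (gen R i) = b i) /\
    (forall psi : {lrmorphism K0 R n -> S},
       (forall i, psi (gen R i) = b i) -> psi =1 phi).
Proof.
move=> b_sqr b_comm.
pose bA (A : {set 'I_n}) : S := \prod_i b i ^+ (i \in A).
pose phi (U : K0 R n) : S := \sum_A coef U A *: bA A.
have bAM A B : bA A * bA B = (-1) ^+ #|A :&: B| *: bA (symdiff A B).
  rewrite /bA -prodrM_comm => [|i j _ _]; last first.
    by apply: commrX; apply: commr_sym; apply: commrX; apply: b_comm.
  have -> : (-1) ^+ #|A :&: B| *: bA (symdiff A B)
      = \prod_i (((-1 : R) ^+ (i \in A :&: B)) *: b i ^+ (i \in symdiff A B)).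
    by rewrite scaler_prod -sign_cardE.
  apply: eq_bigr => i _; rewrite !inE.
  case: (i \in A); case: (i \in B); rewrite /= ?expr0 ?expr1 ?mulr1 ?mul1r;
    by rewrite ?scale1r // b_sqr scaleN1r.
have phiB A : phi (K0_basis R A) = bA A.
  rewrite /phi (bigD1 A) //= coef_basis eqxx scale1r big1 ?addr0 // => D neqDA.
  by rewrite coef_basis (negPf neqDA) scale0r.
have phi_lin : linear phi.
  move=> a U V; rewrite /phi scaler_sumr -big_split; apply: eq_bigr => A _ /=.
  by rewrite coefD coefZ scalerDl scalerA.
pose phiL : {linear K0 R n -> S} :=
  HB.pack phi (GRing.isLinear.Build R (K0 R n) S *:%R phi phi_lin).
have phiZ a U : phi (a *: U) = a *: phi U by exact: (linearZ_LR phiL).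
have phi_sum (F : {set 'I_n} -> K0 R n) : phi (\sum_A F A) = \sum_A phi (F A).
  by exact: (linear_sum phiL).
have phiM A B :
    phi (K0_basis R A * K0_basis R B) = phi (K0_basis R A) * phi (K0_basis R B).
  by rewrite -[_ * _ in LHS]/(K0_mul _ _) K0_mul_basis phiZ !phiB bAM.
have phi_mon : monoid_morphism phi.
  split.
    rewrite -[1]/(K0_basis R set0) phiB /bA big1 // => i _.
    by rewrite inE expr0.
  move=> U V; rewrite [U]K0_expand_basis [V]K0_expand_basis mulr_suml.
  rewrite !phi_sum mulr_suml; apply: eq_bigr => A _.
  rewrite mulr_sumr phi_sum mulr_sumr; apply: eq_bigr => B _.
  by rewrite -scalerAl -scalerAr !phiZ phiM -scalerAl -scalerAr.
pose phiLR : {lrmorphism K0 R n -> S} :=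
  HB.pack phi (GRing.isLinear.Build R (K0 R n) S *:%R phi phi_lin)
    (GRing.isMonoidMorphism.Build (K0 R n) S phi phi_mon).
have phi_gen i : phiLR (gen R i) = b i.
  rewrite -[LHS]/(phi (K0_basis R [set i])) phiB /bA.
  rewrite (eq_bigr (fun j => if j == i then b j else 1)) => [|j _].
    by rewrite -big_mkcond big_pred1_eq.
  by rewrite inE; case: eqP.
exists phiLR; split=> // psi psi_gen U.
rewrite [U]K0_expand [LHS]linear_sum [RHS]linear_sum; apply: eq_bigr => A _.
rewrite [LHS]linearZ_LR [RHS]linearZ_LR; congr (_ *: _).
rewrite /eA [LHS]rmorph_prod [RHS]rmorph_prod; apply: eq_bigr => i _.
exact: etrans (psi_gen i) (esym (phi_gen i)).
Qed.

Section Definitions.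
Local Open Scope complex_scope.
Variables (R : realType) (n : nat).
Local Notation K := (K0 R n).
Implicit Types (U V : K) (A B D : {set 'I_n}).

Definition grade (k : nat) U : K :=
  \sum_(A : {set 'I_n} | #|A| == k) coef U A *: eA R A.

Definition conj1 (l : 'I_n) U : K :=
  \sum_A coef U A *: (if l \in A then - eA R A else eA R A).

Definition conjB B U : K := foldl (fun V l => conj1 l V) U (enum B).

Definition f_elt : K := (2 ^+ n.-1)^-1 *: \sum_(A : {set 'I_n}) eA R A.

Definition E_elt : K := \sum_(0 <= k < n./2.+1) (-1) ^+ k *: grade k.*2 f_elt.

Definition O_elt : K :=
  \sum_(0 <= k < n./2.+1) (-1) ^+ k *: grade k.*2.+1 f_elt.

Definition EB B : K := conjB B E_elt.
Definition OB B : K := conjB B O_elt.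

(* 'i is the imaginary unit Complex 0 1 of R[i]. *)
Definition gamma A U : R[i] :=
  \sum_(D : {set 'I_n}) (coef U D)%:C * ((-1) ^+ #|A :&: D| * 'i ^+ #|D|).

Definition zetaR A U : R := complex.Re (gamma A U).
Definition zetaI A U : R := complex.Im (gamma A U).

Lemma grade_eA k A : grade k (eA R A) = if #|A| == k then eA R A else 0.
Proof.
rewrite /grade; case: ifP => Ak.
  rewrite (bigD1 A Ak) /= coef_eA eqxx scale1r big1 ?addr0 // => D /andP[_ nDA].
  by rewrite coef_eA (negPf nDA) scale0r.
rewrite big1 // => D /eqP Dk; rewrite coef_eA; case: eqP => [eqDA|_].
  by rewrite -eqDA Dk eqxx in Ak.
by rewrite scale0r.
Qed.

Lemma conj1_eA l A : conj1 l (eA R A) = if l \in A then - eA R A else eA R A.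
Proof.
rewrite /conj1 (bigD1 A) //= coef_eA eqxx scale1r big1 ?addr0 // => D nDA.
by rewrite coef_eA (negPf nDA) scale0r.
Qed.

Lemma gamma_eA A D : gamma A (eA R D) = (-1) ^+ #|A :&: D| * 'i ^+ #|D|.
Proof.
rewrite /gamma (bigD1 D) //= coef_eA eqxx mul1r big1 ?addr0 // => B nBD.
by rewrite coef_eA (negPf nBD) mul0r.
Qed.

Lemma gamma_linear A a U V : gamma A (a *: U + V) = a%:C * gamma A U + gamma A V.
Proof.
rewrite /gamma mulr_sumr -big_split; apply: eq_bigr => D _ /=.
by rewrite coefD coefZ rmorphD rmorphM mulrDl mulrA.
Qed.

End Definitions.
Arguments EB R {n} B.
Arguments OB R {n} B.

(* Main.v *)
Require Import Defs.
From mathcomp Require Import all_boot all_order all_algebra.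
From mathcomp Require Import reals complex.
Set Implicit Arguments.
Unset Strict Implicit.
Unset Printing Implicit Defensive.
Import Order.TTheory GRing.Theory Num.Theory.
(* The coordinate lemmas coefD, coefZ and coef_sum must take precedence over
   their homonyms for polynomials. *)
Import Defs.
Local Open Scope ring_scope.

(** Since [gamma C] respects products, it makes R[i] a module over the algebra,
    and the algebra contains a copy of this module as an ideal.  The copy is the
    image of the transpose of [gamma C] for the real inner product
    (w, z) |-> Re (w^* z) on R[i] and the inner product making the [eA A]
    orthonormal: it sends [w] to the element [gamma_adj C w] whose coordinate
    on [eA A] is Re (w^* gamma C (eA A)).

    The numbers [gamma C (eA B)] have modulus 1, so that multiplication by
    [eA B] and multiplication by [gamma C (eA B)] are both orthogonal.  As
    [gamma C] intertwines them, so does its transpose, and by linearity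
    [U * gamma_adj C w = gamma_adj C (gamma C U * w)] for every [U]
    ([mul_gamma_adj]).

    Finally the signs that define [E_elt] and [O_elt] are the real and imaginary
    parts of the powers of i, and the conjugations along [C] supply the signs
    (-1) ^ |C :&: A|.  Hence, up to the same scalar, [EB R C] and [OB R C] are
    [gamma_adj C 1] and [gamma_adj C 'i] ([EB_gamma_adj], [OB_gamma_adj]); the
    theorem is the equivariance at [w = 1], with [gamma C U] written in the real
    basis (1, i). *)

(** * Powers of i and the inner product on R[i] *)

Section ComplexFacts.
Local Open Scope complex_scope.
Variable R : realType.
Implicit Types (w z : R[i]) (a b : R).

Lemma Re_scale a z : complex.Re (a%:C * z) = a * complex.Re z.
Proof. by case: z => x y /=; rewrite mul0r subr0. Qed.

Lemma Im_scale a z : complex.Im (a%:C * z) = a * complex.Im z.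
Proof. by case: z => x y /=; rewrite mul0r addr0. Qed.

Lemma expi_double k : 'i ^+ k.*2 = ((-1) ^+ k)%:C :> R[i].
Proof. by rewrite -mul2n exprM sqr_i rmorphXn rmorphN1. Qed.

Lemma Re_expi m :
  complex.Re ('i ^+ m : R[i]) = if odd m then 0 else (-1) ^+ m./2.
Proof.
rewrite -{1}(odd_double_half m) exprD expi_double mulrC Re_scale.
by case: (odd m); rewrite ?expr1 ?expr0 /= ?mulr0 ?mulr1.
Qed.

Lemma Im_expi m :
  complex.Im ('i ^+ m : R[i]) = if odd m then (-1) ^+ m./2 else 0.
Proof.
rewrite -{1}(odd_double_half m) exprD expi_double mulrC Im_scale.
by case: (odd m); rewrite ?expr1 ?expr0 /= ?mulr0 ?mulr1.
Qed.

Lemma sign_complex m : (-1) ^+ m = ((-1) ^+ m)%:C :> R[i].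
Proof. by rewrite rmorphXn rmorphN1. Qed.

Definition inner w z : R := complex.Re (w^*%C * z).

Lemma innerE w z :
  inner w z = complex.Re w * complex.Re z + complex.Im w * complex.Im z.
Proof. by case: w z => a b [c d]; rewrite /inner /= mulNr opprK. Qed.

Lemma innerZr a w z : inner w (a%:C * z) = a * inner w z.
Proof. by rewrite !innerE Re_scale Im_scale mulrDr !(mulrCA a). Qed.

Lemma innerZl a w z : inner (a%:C * w) z = a * inner w z.
Proof. by rewrite !innerE Re_scale Im_scale mulrDr !mulrA. Qed.

Lemma innerDl w w' z : inner (w + w') z = inner w z + inner w' z.
Proof. by rewrite /inner rmorphD mulrDl raddfD. Qed.

(** Multiplication by a number of modulus 1 is an isometry of the plane. *)
Lemma inner_mul_unit x w z : x^*%C * x = 1 -> inner (x * w) (x * z) = inner w z.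
Proof.
by move=> x1; rewrite /inner rmorphM mulrACA x1 mul1r.
Qed.

End ComplexFacts.

(** * Coordinates of products, conjugates, E and O *)

Section Coordinates.
Local Open Scope complex_scope.
Variables (R : realType) (n : nat).
Local Notation K := (K0 R n).
Implicit Types (U V : K) (A B C D : {set 'I_n}).

Lemma symdiffK A B : symdiff A (symdiff A B) = B.
Proof. by apply/setP=> i; rewrite !inE addKb. Qed.

Lemma coef_mul_eA B V D :
  coef (eA R B * V) D = (-1) ^+ #|B :&: symdiff B D| * coef V (symdiff B D).
Proof.
rewrite {1}[V]K0_expand_basis mulr_sumr coef_sum (bigD1 (symdiff B D)) //=.
rewrite big1 => [|A neqA]; rewrite -scalerAr coefZ eA_basis
  -[_ * K0_basis _ _]/(K0_mul _ _) K0_mul_basis coefZ coef_basis.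
  by rewrite symdiffK eqxx mulr1 addr0 mulrC.
case: eqP => [eqD|_]; last by rewrite !mulr0.
by rewrite eqD symdiffK eqxx in neqA.
Qed.

Lemma coef_grade k U A : coef (grade k U) A = if #|A| == k then coef U A else 0.
Proof.
rewrite /grade coef_sum big_mkcond (bigD1 A) //= big1 => [|D neqDA].
  by rewrite addr0; case: ifP => // _; rewrite coefZ coef_eA eqxx mulr1.
by case: ifP => // _; rewrite coefZ coef_eA eq_sym (negPf neqDA) mulr0.
Qed.

Lemma coef_conj1 l U A : coef (conj1 l U) A = (-1) ^+ (l \in A) * coef U A.
Proof.
have signE D :
    (if l \in D then - eA R D else eA R D) = (-1) ^+ (l \in D) *: eA R D.
  by case: (l \in D); rewrite ?expr1 ?expr0 ?scaleN1r ?scale1r.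
rewrite /conj1 coef_sum (bigD1 A) //= big1 => [|D neqDA].
  by rewrite addr0 signE !coefZ coef_eA eqxx mulr1 mulrC.
by rewrite signE !coefZ coef_eA eq_sym (negPf neqDA) !mulr0.
Qed.

Lemma coef_conjB B U A : coef (conjB B U) A = (-1) ^+ #|B :&: A| * coef U A.
Proof.
have -> : #|B :&: A| = count (mem A) (enum B).
  rewrite -sum1_card -sum1_count big_enum_cond.
  by apply: eq_bigl => i; rewrite inE.
rewrite /conjB; elim: (enum B) U => [|l s IHs] U /=.
  by rewrite expr0 mul1r.
by rewrite IHs coef_conj1 mulrA addnC exprD.
Qed.

Lemma coef_f A : coef (f_elt R n) A = (2 ^+ n.-1)^-1.
Proof.
rewrite coefZ coef_sum (bigD1 A) //= coef_eA eqxx big1 ?addr0 ?mulr1 // => D.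
by rewrite coef_eA eq_sym => /negPf ->.
Qed.

(** With [g k] the double of [k], or its successor, this computes [E_elt] and
    [O_elt] on the sets whose cardinality has the parity of [g]: only the
    grade #|A| contributes. *)
Lemma coef_alternating_grades (g : nat -> nat) A k0 :
  injective g -> g k0 = #|A| -> (k0 < n./2.+1)%N ->
  coef (\sum_(0 <= k < n./2.+1) (-1) ^+ k *: grade (g k) (f_elt R n)) A
  = (2 ^+ n.-1)^-1 * (-1) ^+ k0.
Proof.
move=> g_inj gk0 lt_k0.
rewrite big_mkord coef_sum (bigD1 (Ordinal lt_k0)) //= big1 => [|k neqk].
  by rewrite addr0 coefZ coef_grade gk0 eqxx coef_f mulrC.
rewrite coefZ coef_grade -gk0 (inj_eq g_inj) eq_sym.
by rewrite -[_ == _]/(k == Ordinal lt_k0) (negPf neqk) mulr0.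
Qed.

Lemma coef_no_grade (g : nat -> nat) A :
  (forall k, g k != #|A|) ->
  coef (\sum_(0 <= k < n./2.+1) (-1) ^+ k *: grade (g k) (f_elt R n)) A = 0.
Proof.
move=> g_neq; rewrite coef_sum big1 // => k _.
by rewrite coefZ coef_grade eq_sym (negPf (g_neq k)) mulr0.
Qed.

(** The summations defining [E_elt] and [O_elt] reach every grade, since #|A| is
    at most [n]. *)
Let card_le A : (#|A|./2 <= n./2)%N.
Proof. by rewrite half_leq // -[leqRHS]card_ord max_card. Qed.

Lemma coef_E A :
  coef (E_elt R n) A = (2 ^+ n.-1)^-1 * complex.Re ('i ^+ #|A| : R[i]).
Proof.
rewrite Re_expi; case: ifPn => [oddA|evenA].
  rewrite mulr0 coef_no_grade // => k.
  by apply: contraTneq oddA => <-; rewrite odd_double.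
apply: coef_alternating_grades; last by rewrite ltnS card_le.
  exact: double_inj.
by rewrite even_halfK.
Qed.

Lemma coef_O A :
  coef (O_elt R n) A = (2 ^+ n.-1)^-1 * complex.Im ('i ^+ #|A| : R[i]).
Proof.
rewrite Im_expi; case: ifPn => [oddA|evenA].
  apply: (@coef_alternating_grades (fun k => k.*2.+1)).
  - by move=> j k [] /double_inj.
  - by rewrite odd_halfK // prednK // odd_gt0.
  by rewrite ltnS card_le.
rewrite mulr0 (@coef_no_grade (fun k => k.*2.+1)) // => k.
by apply: contraNneq evenA => <-; rewrite /= odd_double.
Qed.

(** * The transpose of gamma *)

(** This is the multiplicativity of [gamma A], in view of the product of two
    basis elements. *)
Lemma gamma_eA_mul A B D :
  gamma A (eA R B) * gamma A (eA R D)
  = ((-1) ^+ #|B :&: D|)%:C * gamma A (eA R (symdiff B D)).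
Proof.
(* Both sides are products over all the generators, compared one by one; the
   sign comes from the generators common to B and D. *)
pose t (i : 'I_n) : R[i] := (-1) ^+ (i \in A) * 'i.
have gammaE X : gamma A (eA R X) = \prod_i t i ^+ (i \in X).
  rewrite gamma_eA sign_cardE -prodr_const [X in _ * X]big_mkcond -big_split /=.
  apply: eq_bigr => i _; rewrite inE /t.
  by case: (i \in X); rewrite ?andbT ?andbF ?expr0 ?expr1 ?mulr1.
have tt i : t i * t i = -1.
  by rewrite /t mulrACA -expr2 sqrr_sign mul1r -expr2 sqr_i.
rewrite -sign_complex !gammaE sign_cardE -!big_split; apply: eq_bigr => i _ /=.
by rewrite !inE; case: (i \in B); case: (i \in D);
  rewrite ?expr0 ?expr1 ?mulr1 ?mul1r // tt.
Qed.

Lemma gamma_eA_unit A B : (gamma A (eA R B))^*%C * gamma A (eA R B) = 1.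
Proof.
have ii1 : ('i : R[i])^*%C * 'i = 1 by simpc.
rewrite gamma_eA rmorphM !rmorphXn rmorphN1 mulrACA -!exprMn.
by rewrite mulN1r opprK ii1 !expr1n mulr1.
Qed.

Definition gamma_adj C (w : R[i]) : K :=
  \sum_A inner w (gamma C (eA R A)) *: eA R A.

Lemma coef_gamma_adj C w A :
  coef (gamma_adj C w) A = inner w (gamma C (eA R A)).
Proof.
rewrite coef_sum (bigD1 A) //= coefZ coef_eA eqxx mulr1 big1 ?addr0 // => D.
by rewrite coefZ coef_eA eq_sym => /negPf ->; rewrite mulr0.
Qed.

Lemma gamma_adjD C w z : gamma_adj C (w + z) = gamma_adj C w + gamma_adj C z.
Proof. by apply: coefP => A; rewrite coefD !coef_gamma_adj innerDl. Qed.

Lemma gamma_adjZ C a w : gamma_adj C (a%:C * w) = a *: gamma_adj C w.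
Proof. by apply: coefP => A; rewrite coefZ !coef_gamma_adj innerZl. Qed.

(** An orthogonal operator commutes with the transpose of a map as soon as it
    commutes with the map, its inverse being its own transpose; concretely,
    [inner_mul_unit] moves [gamma C (eA R B)] from one argument to the other. *)
Lemma mul_eA_gamma_adj C B w :
  eA R B * gamma_adj C w = gamma_adj C (gamma C (eA R B) * w).
Proof.
apply: coefP => D; rewrite coef_mul_eA !coef_gamma_adj -innerZr.
(* Multiplying the second argument by [gamma C (eA R B)] turns the coordinate
   [symdiff B D] into [D], with the square of a sign in front. *)
rewrite -[LHS](inner_mul_unit _ _ (gamma_eA_unit C B)) mulrCA.
rewrite gamma_eA_mul symdiffK mulrA -rmorphM /=.
by rewrite -expr2 sqrr_sign mul1r.
Qed.

Lemma mul_gamma_adj C U w : U * gamma_adj C w = gamma_adj C (gamma C U * w).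
Proof.
have gamma_adj_sum (F : {set 'I_n} -> R[i]) :
    gamma_adj C (\sum_A F A) = \sum_A gamma_adj C (F A).
  apply: (big_morph (gamma_adj C) (gamma_adjD C)).
  apply: coefP => D.
  by rewrite coef_gamma_adj innerE /= !mul0r addr0 /coef ffunE.
rewrite {1}[U]K0_expand /gamma !mulr_suml gamma_adj_sum.
apply: eq_bigr => A _.
by rewrite -gamma_eA -mulrA gamma_adjZ -mul_eA_gamma_adj scalerAl.
Qed.

(** Pairing with 1 extracts the real part of [gamma C (eA R A)], and pairing with
    'i the imaginary part; up to the scalar coming from [f_elt], these are the
    coordinates of [EB R C] and [OB R C]. *)
Lemma EB_gamma_adj C : EB R C = (2 ^+ n.-1)^-1 *: gamma_adj C 1.
Proof.
apply: coefP => A; rewrite /EB coef_conjB coef_E coefZ coef_gamma_adj gamma_eA.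
by rewrite sign_complex innerZr innerE /= mul1r mul0r addr0 mulrCA.
Qed.

Lemma OB_gamma_adj C : OB R C = (2 ^+ n.-1)^-1 *: gamma_adj C 'i.
Proof.
apply: coefP => A; rewrite /OB coef_conjB coef_O coefZ coef_gamma_adj gamma_eA.
by rewrite sign_complex innerZr innerE /= mul1r mul0r add0r mulrCA.
Qed.

End Coordinates.

Theorem theorem6p9 (R : realType) (n : nat) (n_ge1 : (1 <= n)%N) (U : K0 R n)
    (C : {set 'I_n}) (C_sub : C \subset [set i : 'I_n | (0 < i)%N]) :
  U * EB R C = zetaR C U *: EB R C + zetaI C U *: OB R C.
Proof.
rewrite EB_gamma_adj OB_gamma_adj -scalerAr mul_gamma_adj mulr1.
have -> : gamma C U
    = real_complex R (zetaR C U) * 1 + real_complex R (zetaI C U) * 'i%C.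
  by rewrite /zetaR /zetaI; case: (gamma C U) => a b; simpc.
by rewrite gamma_adjD !gamma_adjZ scalerDr !scalerA ![_ * (_ ^+ _)^-1]mulrC.
Qed.
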